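(* Assume $W_c$ satisfies Assumption 1, let $r>0$, and suppose $rH^{W_s}(M)+H^{W_c}(X|Z)<R$. Then \[ \liminf_{n\to\infty}-\frac1n\log P_j(\lfloor rn\rfloor,n)\ge\sup_{s\in(0,1)}\big[sR-U[W_s,W_c,\downarrow;r](s)\big]. \]
   Context: Setup. $\mathcal M$ finite, $W_s$ an irreducible aperiodic transition matrix on $\mathcal M$; message $M^k$ with law $P_{M_1}(m_1)\prod_{i=2}^kW_s(m_i|m_{i-1})$. $\mathcal X$ a finite abelian group, $\mathcal Z$ finite, $W_c=\{W_c(x,z|x',z')\}$ an irreducible aperiodic transition matrix on $\mathcal X\times\mathcal Z$; noise $(X^n,Z^n)$ with law $P_{X_1Z_1}(x_1,z_1)\prod_{i=2}^nW_c(x_i,z_i|x_{i-1},z_{i-1})$. Channel: input $\tilde x^n$ yields output $(x^n,z^n)$ with probability $P_{X^nZ^n}(x^n-\tilde x^n,z^n)$. $P_j(k,n)$ is the minimum over codes $(\mathsf e:\mathcal M^k\to\mathcal X^n,\ \mathsf d:(\mathcal X\times\mathcal Z)^n\to\mathcal M^k)$ of the average decoding error probability. $R:=\log|\mathcal X|$. Assumption 1: $\sum_xW_c(x,z|x',z')$ does not depend on $x'$; call it $W_{c,Z}(z|z')$. Entrywise powers $a^t$ of transition probabilities are $0$ when $a=0$; $\lambda(A)$ denotes the Perron–Frobenius eigenvalue. $\theta H^{W_s}_{1-\theta}(M):=\log\lambda\big(W_s(m|m')^{1-\theta}\big)$, $\theta H^{W_c,\downarrow}_{1-\theta}(X|Z):=\log\lambda\big(W_c(x,z|x',z')^{1-\theta}W_{c,Z}(z|z')^{\theta}\big)$;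 $H^{W_s}(M):=\lim_{\theta\to0}H^{W_s}_{1-\theta}(M)$, $H^{W_c}(X|Z):=\lim_{\theta\to0}H^{W_c,\downarrow}_{1-\theta}(X|Z)$. $U[W_s,W_c,\downarrow;r](\theta):=r\theta H^{W_s}_{1-\theta}(M)+\theta H^{W_c,\downarrow}_{1-\theta}(X|Z)$. *)

(* Defs.v *)
From Stdlib Require Import Reals ClassicalEpsilon.
From mathcomp Require Import all_boot all_algebra.
Set Implicit Arguments. Unset Strict Implicit. Unset Printing Implicit Defensive.
Local Open Scope R_scope.

Notation "\rsum_ ( i : T ) F" := (\big[Rplus/R0]_(i : T) F)
  (at level 41, F at level 41, i, T at level 50).

Definition epow (a t : R) : R := if Req_EM_T a 0 then 0 else Rpower a t.

(* A : T -> T -> R is read as a transition matrix A(a|b) = A a b *)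
Fixpoint mpow (T : finType) (A : T -> T -> R) (n : nat) (a b : T) : R :=
  match n with
  | O => if a == b then 1 else 0
  | S n' => \rsum_(c : T) (A a c * mpow A n' c b)
  end.

Definition is_distr (T : finType) (P : T -> R) : Prop :=
  (forall a, 0 <= P a) /\ \rsum_(a : T) P a = 1.

Definition is_transition (T : finType) (W : T -> T -> R) : Prop :=
  (forall a b, 0 <= W a b) /\ (forall b, \rsum_(a : T) W a b = 1).

Definition irreducible (T : finType) (W : T -> T -> R) : Prop :=
  forall a b : T, exists n : nat, (0 < n)%nat /\ 0 < mpow W n a b.

Definition aperiodic (T : finType) (W : T -> T -> R) : Prop :=
  forall (a : T) (d : nat),
    (forall n : nat, (0 < n)%nat -> 0 < mpow W n a a -> (d %| n)%N) -> d = 1%N.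

(* Perron-Frobenius eigenvalue of a nonnegative (irreducible) matrix:
   the eigenvalue admitting an entrywise positive eigenvector. *)
Definition PFeig (T : finType) (A : T -> T -> R) : R :=
  epsilon (inhabits 0)
    (fun l => exists v : T -> R, (forall i, 0 < v i) /\
       forall i, \rsum_(j : T) (A i j * v j) = l * v i).

Fixpoint chain_rest (T : finType) (W : T -> T -> R) (prev : T) (s : seq T) : R :=
  match s with
  | [::] => 1
  | x :: s' => W x prev * chain_rest W x s'
  end.

Definition chainP (T : finType) (P1 : T -> R) (W : T -> T -> R) (s : seq T) : R :=
  match s with
  | [::] => 1
  | x :: s' => P1 x * chain_rest W x s'
  end.

(* W_{c,Z}(z|z') := sum_x W_c(x,z|x',z'), evaluated at x' = 0
   (independent of x' under Assumption 1) *)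
Definition WcZ (X : finZmodType) (Z : finType) (Wc : (X * Z) -> (X * Z) -> R)
  (z z' : Z) : R := \rsum_(x : X) Wc (x, z) (GRing.zero, z').

Definition assumption1 (X : finZmodType) (Z : finType)
  (Wc : (X * Z) -> (X * Z) -> R) : Prop :=
  forall (x' x'' : X) (z z' : Z),
    \rsum_(x : X) Wc (x, z) (x', z') = \rsum_(x : X) Wc (x, z) (x'', z').

(* noise sequence (x^n - xt^n, z^n) for output y = (x^n, z^n), input xt *)
Definition noise_of (X : finZmodType) (Z : finType) (n : nat)
  (y : n.-tuple (X * Z)) (xt : n.-tuple X) : seq (X * Z) :=
  map (fun p : (X * Z) * X => (GRing.add p.1.1 (GRing.opp p.2), p.1.2))
      (zip (tval y) (tval xt)).

Notation code_type M X Z k n :=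
  ({ffun k.-tuple M -> n.-tuple X} * {ffun n.-tuple (X * Z) -> k.-tuple M})%type.

Definition err_prob (M : finType) (X : finZmodType) (Z : finType)
  (PM1 : M -> R) (Ws : M -> M -> R) (PXZ1 : (X * Z) -> R)
  (Wc : (X * Z) -> (X * Z) -> R) (k n : nat) (c : code_type M X Z k n) : R :=
  \rsum_(m : k.-tuple M)
     (chainP PM1 Ws (tval m) *
      \rsum_(y : n.-tuple (X * Z))
         (if c.2 y != m then chainP PXZ1 Wc (noise_of y (c.1 m)) else 0)).

(* P_j(k,n): minimum over all codes (the code type is finite and nonempty) *)
Definition Pj (M : finType) (X : finZmodType) (Z : finType)
  (PM1 : M -> R) (Ws : M -> M -> R) (PXZ1 : (X * Z) -> R)
  (Wc : (X * Z) -> (X * Z) -> R) (k n : nat) : R :=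
  let l := [seq err_prob PM1 Ws PXZ1 Wc c | c <- enum {: code_type M X Z k n}] in
  foldr Rmin (head 0 l) l.

Definition thetaHs (M : finType) (Ws : M -> M -> R) (theta : R) : R :=
  ln (PFeig (fun m m' => epow (Ws m m') (1 - theta))).

Definition thetaHc (X : finZmodType) (Z : finType)
  (Wc : (X * Z) -> (X * Z) -> R) (theta : R) : R :=
  ln (PFeig (fun a b => epow (Wc a b) (1 - theta) * epow (WcZ Wc a.2 b.2) theta)).

Definition Ufun (M : finType) (X : finZmodType) (Z : finType)
  (Ws : M -> M -> R) (Wc : (X * Z) -> (X * Z) -> R) (r theta : R) : R :=
  r * thetaHs Ws theta + thetaHc Wc theta.

Definition floor_nat (x : R) : nat := Z.to_nat (Int_part x).

(* Main.v *)
(** Random coding with a uniform code book and MAP decoding.  If the MAP decoder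
  errs on message m at output y, then p(m) w(e(m), y) is at most
  B := sum_(m' <> m) p(m') w(e(m'), y), hence at most
  (p(m) w(e(m), y))^(1-s) B^s.  Bounding B^s by its tangent at the mean q(y) of
  w(., y) over inputs makes the bound affine in e(m'), and pairwise independence of
  the code words averages it to p(m)^(1-s) w^(1-s) q(y)^s.  For additive noise
  q(y) = P_Z(z) / |X|^n, and Assumption 1 makes P_Z a Markov chain with kernel
  W_(c,Z); so both factors are total masses of chains with kernels W_s^(1-s) and
  W_c^(1-s) W_(c,Z)^s, which grow like powers of the Perron-Frobenius eigenvalues. *)
Require Import Defs.
From Stdlib Require Import Reals ClassicalEpsilon Lra Lia Psatz.
From mathcomp Require Import all_boot all_order all_algebra.
From mathcomp Require Import boolp classical_sets reals topology normedtype derive.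
From mathcomp Require Import Rstruct ring lra.
Set Implicit Arguments. Unset Strict Implicit. Unset Printing Implicit Defensive.
Import Order.TTheory GRing.Theory Num.Theory.
Import numFieldTopology.Exports numFieldNormedType.Exports.
Local Open Scope ring_scope.
(* [epow] is declared in [R_scope]; ring operations are wanted in its arguments *)
Local Arguments epow (a t)%_ring_scope.

(** * Perron-Frobenius: existence of a positive eigenvector *)

Definition mact (R : realType) (T : finType) (A : T -> T -> R) (x : T -> R) : T -> R :=
  fun i => \sum_j A i j * x j.

Section PerronFrobenius.
Local Open Scope classical_set_scope.
Variables (R : realType) (T : finType) (A : T -> T -> R).
Hypothesis A_ge0 : forall i j, 0 <= A i j.
Hypothesis A_irr : forall i j, exists n, 0 < iter n (mact A) (fun k => (k == j)%:R) i.

Lemma mactDZ (a : R) x y :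
  mact A (fun i => a * x i + y i) = (fun i => a * mact A x i + mact A y i).
Proof.
apply: funext => i; rewrite /mact mulr_sumr -big_split /=.
by apply: eq_bigr => j _; rewrite mulrDr mulrCA.
Qed.

Lemma iter_mactDZ n (a : R) x y :
  iter n (mact A) (fun i => a * x i + y i) =
  (fun i => a * iter n (mact A) x i + iter n (mact A) y i).
Proof. by elim: n => //= n ->; rewrite mactDZ. Qed.

Lemma iter_mact_ge0 n x : (forall i, 0 <= x i) -> forall i, 0 <= iter n (mact A) x i.
Proof.
move=> x0; elim: n => //= n IH i.
by apply: sumr_ge0 => j _; rewrite mulr_ge0.
Qed.

(** The pairs of a point of the simplex and a value [l >= 0] with [l x <= A x] form a compact set:
    summing over coordinates bounds [l] by the total [C] of the entries. So [l] attains its maximum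
    there, and negative [l'] are dominated trivially. Functions on [T] are coded as row vectors to
    have compact cubes at hand. *)
Lemma collatz_wielandt_max (t0 : T) : exists (l : R) (x : T -> R),
  [/\ forall i, 0 <= x i, \sum_i x i = 1, forall i, l * x i <= mact A x i &
   forall (l' : R) (x' : T -> R), (forall i, 0 <= x' i) -> \sum_i x' i = 1 ->
     (forall i, l' * x' i <= mact A x' i) -> l' <= l].
Proof.
pose n := #|T|.
pose toF (v : 'rV[R]_n) : T -> R := fun t => v ord0 (enum_rank t).
pose K := [set v : 'rV[R]_n | forall i, `[0, 1]%classic (v ord0 i)].
pose C := \sum_i \sum_j A i j.
have C0 : 0 <= C by apply: sumr_ge0 => i _; apply: sumr_ge0.
pose S := [set p : 'rV[R]_n * R | [/\ forall i, 0 <= toF p.1 i, \sum_i toF p.1 i = 1,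
   forall i, p.2 * toF p.1 i <= mact A (toF p.1) i & 0 <= p.2]].
have le1 (x : T -> R) : (forall i, 0 <= x i) -> \sum_i x i = 1 -> forall i, x i <= 1.
  by move=> x0 <- i; rewrite (bigD1 i) //= lerDl sumr_ge0.
have leC l x : (forall i, 0 <= x i) -> \sum_i x i = 1 ->
    (forall i, l * x i <= mact A x i) -> l <= C.
  move=> x0 x1 lx; rewrite -[l]mulr1 -x1 mulr_sumr; apply: ler_sum => i _.
  apply: le_trans (lx i) _; apply: ler_sum => j _.
  by rewrite ler_piMr // le1.
have SK : S `<=` K `*` `[0, C]%classic.
  move=> [v l] [/= v0 v1 lv l0]; split => /=.
    move=> i; rewrite /= in_itv /=.
    have := v0 (enum_val i); have := le1 _ v0 v1 (enum_val i).
    by rewrite /toF enum_valK => -> ->.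
  by rewrite in_itv /= l0 /= (leC _ _ v0 v1).
have Kc : compact (K `*` `[0, C]%classic).
  apply: compact_setX; last exact: segment_compact.
  by apply: (@rV_compact R n (fun=> `[0, 1]%classic)) => i; exact: segment_compact.
have ctoF t : continuous (fun p : 'rV[R]_n * R => toF p.1 t).
  move=> p; rewrite /toF.
  exact: (continuous_comp (@cvg_fst _ _ _ _ _) (@coord_continuous _ _ _ _ _ _)).
have cmact t : continuous (fun p : 'rV[R]_n * R => mact A (toF p.1) t).
  move=> p; rewrite /mact; apply: cvg_big => [|j _]; [exact: add_continuous|].
  by apply: cvgM; [exact: cvg_cst | exact: ctoF].
have Scl : closed S.
  have -> : S = (\bigcap_i ((fun p : 'rV[R]_n * R => toF p.1 i) @^-1` [set x | 0 <= x]))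
    `&` ((fun p : 'rV[R]_n * R => \sum_i toF p.1 i) @^-1` [set x | x = 1])
    `&` (\bigcap_i ((fun p : 'rV[R]_n * R => mact A (toF p.1) i - p.2 * toF p.1 i) @^-1` [set x | 0 <= x]))
    `&` ((fun p : 'rV[R]_n * R => p.2) @^-1` [set x | 0 <= x]).
    apply/seteqP; split => [[v l] [/= h1 h2 h3 h4]|[v l] [[[/= h1 h2] h3] h4]].
      by do 3?split => //; move=> i _ /=; rewrite ?subr_ge0.
    by split => //= i; [exact: h1 | rewrite -subr_ge0; exact: h3].
  apply: closedI; [apply: closedI; [apply: closedI|]|].
  - by apply: closed_bigI => i _; apply: preimage_closed; [move=> ? _; exact: ctoF | exact: closed_ge].
  - apply: preimage_closed; last exact: closed_eq.
    by move=> ? _; apply: cvg_big => [|j _]; [exact: add_continuous|]; exact: ctoF.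
  - apply: closed_bigI => i _; apply: preimage_closed; last exact: closed_ge.
    by move=> p _; apply: cvgB; [exact: cmact | apply: cvgM; [exact: cvg_snd | exact: ctoF]].
  - by apply: preimage_closed; [move=> ? _; exact: cvg_snd | exact: closed_ge].
have Sc : compact S by exact: subclosed_compact Scl Kc SK.
have S0 : S !=set0.
  exists (\row_i (i == enum_rank t0)%:R, 0); split => //=.
  - by move=> i; rewrite /toF mxE ler0n.
  - rewrite (bigD1 t0) //= big1 ?addr0 /toF ?mxE ?eqxx // => i /negbTE it0.
    by rewrite mxE (inj_eq enum_rank_inj) it0.
  - move=> i; rewrite mul0r; apply: sumr_ge0 => j _.
    by rewrite mulr_ge0 // /toF mxE ler0n.
have cS : {within S, continuous (fun p : 'rV[R]_n * R => p.2)}.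
  by apply: continuous_subspaceT => ?; exact: cvg_snd.
have [[v l] /set_mem [/= v0 v1 lv l0] max] := compact_EVT_max S0 Sc cS.
exists l, (toF v); split => // l' x' x'0 x'1 l'x'.
have [l'0|l'0] := ltP l' 0; first by rewrite (le_trans (ltW l'0)).
have E : toF (\row_i x' (enum_val i)) = x'.
  by apply: funext => t; rewrite /toF mxE enum_rankK.
by apply: (max (\row_i x' (enum_val i), l')); apply/mem_set; rewrite /S /= E.
Qed.

Lemma perron_frobenius_exists (t0 : T) : exists (l : R) (v : T -> R),
  (forall i, 0 < v i) /\ forall i, mact A v i = l * v i.
Proof.
have [l [x [x0 x1 lx lmax]]] := collatz_wielandt_max t0.
have [N irr] := choice (fun p : T * T => A_irr p.1 p.2).
(* P is a positive matrix commuting with A: if A x <> l x, then P x is a strict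
   super-eigenvector for l, against the maximality of l. *)
pose P (z : T -> R) i := \sum_p iter (N p) (mact A) z i.
have PDZ a z w : P (fun i => a * z i + w i) = fun i => a * P z i + P w i.
  apply: funext => i; rewrite /P mulr_sumr -big_split /=.
  by apply: eq_bigr => p _; rewrite iter_mactDZ.
have PA z : mact A (P z) = P (mact A z).
  apply: funext => i; rewrite /P /mact.
  under eq_bigr do rewrite mulr_sumr.
  by rewrite exchange_big; apply: eq_bigr => p _; rewrite -iterSr.
have P_gt0 z j : (forall i, 0 <= z i) -> 0 < z j -> forall i, 0 < P z i.
  move=> z0 zj i.
  (* Split off the mass of [z] at [j]. Irreducibility carries it to [i] in the summand of index
     [(i, j)], and the remainder stays nonnegative. *)
  have E : z = fun k => z j * (k == j)%:R + (z k - z j * (k == j)%:R).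
    by apply: funext => k; rewrite addrC subrK.
  rewrite /P (bigD1 (i, j)) //=; apply: ltr_pwDl; last first.
    by apply: sumr_ge0 => p _; exact: iter_mact_ge0.
  rewrite E iter_mactDZ; apply: ltr_pwDl; first by rewrite mulr_gt0 ?irr.
  apply: iter_mact_ge0 => k.
  by case: eqP => [->|_]; rewrite ?mulr1 ?subrr // mulr0 subr0.
have [j xj] : exists j, 0 < x j.
  apply: contrapT => h; have : \sum_i x i = 0.
    apply: big1 => i _; apply/eqP; rewrite eq_le x0 andbT leNgt.
    by apply/negP => xi; apply: h; exists i.
  by rewrite x1 => /eqP; rewrite oner_eq0.
have Px := P_gt0 _ _ x0 xj.
pose y i := mact A x i - l * x i.
have y0 i : 0 <= y i by rewrite subr_ge0.
have Ey : mact A x = fun i => l * x i + y i.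
  by apply: funext => i; rewrite /y addrC subrK.
have APx : mact A (P x) = fun i => l * P x i + P y i by rewrite PA Ey PDZ.
have yz k : y k = 0.
  apply/eqP; rewrite eq_le y0 andbT leNgt; apply/negP => yk.
  have Py := P_gt0 _ _ y0 yk.
  pose s := \sum_i P x i.
  have s0 : 0 < s.
    rewrite /s (bigD1 t0) //=; apply: ltr_pwDl => //.
    by apply: sumr_ge0 => i _; exact: ltW.
  (* Since A(P x) = l P x + P y, the least ratio [e] of [P y] to [P x] is an amount by which [l]
     could be raised, once [P x] is divided by its sum [s]. *)
  have [i0 _ mini] := arg_minP (P := xpredT) (fun i => P y i / P x i) (erefl : xpredT t0).
  pose e := P y i0 / P x i0.
  have e0 : 0 < e by rewrite divr_gt0.
  have : l + e <= l.
    apply: (lmax _ (fun i => s^-1 * P x i + 0)).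
    - by move=> i; rewrite addr0 mulr_ge0 ?ltW ?invr_gt0.
    - by under eq_bigr do rewrite addr0; rewrite -mulr_sumr mulVf // gt_eqF.
    - move=> i; rewrite mactDZ APx.
      rewrite [mact A _ i]big1 ?addr0; last by move=> ? _; rewrite mulr0.
      rewrite mulrCA ler_pM2l ?invr_gt0 // mulrDl lerD2l -ler_pdivlMr //.
      exact: mini.
  by rewrite gerDl leNgt e0.
exists l, (P x); split => // i; rewrite APx.
(* As [y] vanishes, linearity gives P y = P y + P y, hence P y = 0. *)
have Ey2 : y = fun k => 1 * y k + y k by apply: funext => k; rewrite yz mulr0 addr0.
have : P y i = 1 * P y i + P y i by rewrite {1}Ey2 PDZ.
lra.
Qed.

End PerronFrobenius.

(** * Real powers that vanish at 0, and the tangent bound *)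

Lemma epow0 t : epow 0 t = 0.
Proof. by rewrite /epow; case: RIneq.Req_dec_T. Qed.

Lemma epow_Rpower a t : 0 < a -> epow a t = Rpower a t.
Proof.
move=> a0; rewrite /epow; case: RIneq.Req_dec_T => E //.
by rewrite E ltxx in a0.
Qed.

Lemma epow_gt0 a t : 0 < a -> 0 < epow a t.
Proof. by move=> a0; rewrite epow_Rpower //; apply/RltP; exact: exp_pos. Qed.

Lemma epow_ge0 a t : 0 <= epow a t.
Proof.
rewrite /epow; case: RIneq.Req_dec_T => //= ?.
by apply/RleP/Rlt_le; exact: exp_pos.
Qed.

Lemma epow1 t : epow 1 t = 1.
Proof. by rewrite epow_Rpower // /Rpower ln_1 Rmult_0_r exp_0. Qed.

Lemma epowM a b t : 0 <= a -> 0 <= b -> epow (a * b) t = epow a t * epow b t.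
Proof.
rewrite !le_eqVlt => /predU1P[<-|a0]; first by rewrite mul0r epow0 mul0r.
case/predU1P=> [<-|b0]; first by rewrite mulr0 epow0 mulr0.
rewrite !epow_Rpower ?mulr_gt0 //.
by apply/esym/Rpower_mult_distr; apply/RltP.
Qed.

Lemma epowD a s t : 0 < a -> epow a (s + t) = epow a s * epow a t.
Proof. by move=> a0; rewrite !epow_Rpower //; exact: Rpower_plus. Qed.

Lemma epow_id a : 0 < a -> epow a 1 = a.
Proof. by move=> a0; rewrite epow_Rpower // Rpower_1 //; apply/RltP. Qed.

Lemma le_epow a b t : 0 <= t -> 0 <= a <= b -> epow a t <= epow b t.
Proof.
move=> t0 /andP[]; rewrite le_eqVlt => /predU1P[<-|a0 ab]; first by rewrite epow0 epow_ge0.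
rewrite !epow_Rpower //; last exact: lt_le_trans ab.
by apply/RleP/Rle_Rpower_l; [exact/RleP | split; [exact/RltP | exact/RleP]].
Qed.

(* weighted AM-GM, from [ln x <= x - 1] at [x = u / t] and [x = 1 / t], t := 1 - s + s u *)
Lemma epow_le_affine u s : 0 < s < 1 -> 0 <= u -> epow u s <= 1 - s + s * u.
Proof.
move=> /andP[s0 s1]; rewrite le_eqVlt => /predU1P[<-|u0].
  by rewrite epow0 mulr0 addr0 subr_ge0 ltW.
have ln_le (x : R) : 0 < x -> ln x <= x - 1.
  move=> /RltP x0; have := exp_ineq1_le (ln x); rewrite exp_ln // => h.
  by apply/RleP; rewrite -RminusE -R1E; Lra.lra.
set t := _ + _.
have t0 : 0 < t by rewrite addr_gt0 ?subr_gt0 ?mulr_gt0.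
have h1 := ln_le _ (divr_gt0 u0 t0).
have h2 : ln (t^-1)%R <= t^-1 - 1 by apply: ln_le; rewrite invr_gt0.
have E1 : ln (u / t)%R = ln u - ln t.
  by rewrite -[LHS]/(ln (Rmult u (Rinv t))) ln_mult ?ln_Rinv //; apply/RltP; rewrite ?RinvE ?invr_gt0.
have E2 : ln (t^-1)%R = - ln t by apply: ln_Rinv; apply/RltP.
have le_ln : s * ln u <= ln t.
  have h3 : s * (ln u - ln t) <= s * (u / t - 1) by rewrite -E1 ler_wpM2l // ltW.
  have h4 : (1 - s) * (- ln t) <= (1 - s) * (t^-1 - 1).
    by rewrite -E2 ler_wpM2l // subr_ge0 ltW.
  have h5 : s * (u / t - 1) + (1 - s) * (t^-1 - 1) = 0.
    have -> : s * (u / t - 1) + (1 - s) * (t^-1 - 1) = t / t - 1 by rewrite /t; ring.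
    by rewrite divff ?subrr // gt_eqF.
  lra.
rewrite epow_Rpower // /Rpower -[X in _ <= X]exp_ln; last exact/RltP.
by apply/RleP; case/RleP: le_ln => [/exp_increasing/Rlt_le|/(congr1 exp)/Req_le].
Qed.

(** Factor [a] as a^(1-s) a^s, enlarge the second factor to B^s = c^s (B/c)^s, and apply
    [epow_le_affine] at B/c. The result is affine in [B], so it can be averaged. *)
Lemma epow_young a B c s : 0 < s < 1 -> 0 <= a <= B -> 0 < c ->
  a <= epow a (1 - s) * epow c s * (1 - s + s * (B / c)).
Proof.
move=> s01 /andP[a0 aB] c0; have B0 := le_trans a0 aB.
move: a0; rewrite le_eqVlt => /predU1P[<-|a0]; first by rewrite epow0 !mul0r.
rewrite -{1}[a]epow_id // -{1}(subrK s 1) epowD // -mulrA ler_wpM2l ?epow_ge0 //.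
have [s0 _] := andP s01.
apply: (@le_trans _ _ (epow B s)); first by apply: le_epow; [exact: ltW | rewrite (ltW a0)].
have Bc0 : 0 <= B / c by rewrite divr_ge0 // ltW.
rewrite -{1}(divfK (lt0r_neq0 c0) B) [_ / c * c]mulrC epowM ?(ltW c0) //.
by rewrite ler_wpM2l ?epow_ge0 // epow_le_affine.
Qed.

(** * Uniform averages *)

Definition mean (F : realFieldType) (I : finType) (f : I -> F) : F := (\sum_i f i) / #|I|%:R.

Section Mean.
Variables (F : realFieldType) (I : finType).
Implicit Types f g : I -> F.

Lemma eq_mean f g : f =1 g -> mean f = mean g.
Proof. by move=> fg; rewrite /mean (eq_bigr g). Qed.

Lemma meanD f g : mean (fun x => f x + g x) = mean f + mean g.
Proof. by rewrite /mean big_split /= mulrDl. Qed.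

Lemma meanZ (a : F) f : mean (fun x => a * f x) = a * mean f.
Proof. by rewrite /mean -mulr_sumr mulrA. Qed.

Lemma mean_sum (J : finType) (P : pred J) (f : J -> I -> F) :
  mean (fun x => \sum_(j | P j) f j x) = \sum_(j | P j) mean (f j).
Proof. by rewrite /mean exchange_big mulr_suml. Qed.

Lemma le_mean f g : (forall x, f x <= g x) -> mean f <= mean g.
Proof. by move=> fg; rewrite /mean ler_wpM2r ?invr_ge0 ?ler0n // ler_sum. Qed.

Lemma mean_ge0 f : (forall x, 0 <= f x) -> 0 <= mean f.
Proof. by move=> f0; rewrite /mean mulr_ge0 ?invr_ge0 ?ler0n // sumr_ge0. Qed.

Lemma mean_const (a : F) : (0 < #|I|)%N -> mean (fun _ : I => a) = a.
Proof.
move=> I0; rewrite /mean; have -> : \sum_(x : I) a = a * #|I|%:R.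
  by rewrite sumr_const mulr_natr.
by rewrite mulfK // pnatr_eq0 -lt0n.
Qed.

Lemma exists_le_mean f : (0 < #|I|)%N -> exists x, f x <= mean f.
Proof.
move=> I0; have /card_gt0P[x0 _] := I0.
have [x _ xmin] := arg_minP (P := xpredT) f (erefl : xpredT x0).
by exists x; rewrite -{1}[f x]mean_const //; apply: le_mean => y; exact: xmin.
Qed.

Lemma mean_eq0 f : (0 < #|I|)%N -> (forall x, 0 <= f x) -> mean f = 0 -> forall x, f x = 0.
Proof.
move=> I0 f0 /eqP; rewrite /mean mulf_eq0 invr_eq0 pnatr_eq0 -(negbK (_ == 0%N)) -lt0n I0 orbF.
by move=> /eqP/psumr_eq0P h x; apply: h.
Qed.

End Mean.

(** * Independence of the code words of a uniform code book *)

Section RandomCode.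
Variables (R : realFieldType) (T I : finType).
Hypothesis I_gt0 : (0 < #|I|)%N.

(** Expanding a product of sums produces one term per function from [T] to [I], and the
    normalisation |I|^|T| splits evenly over the factors. *)
Lemma mean_ffun_prod (F : T -> I -> R) :
  mean (fun e : {ffun T -> I} => \prod_t F t (e t)) = \prod_t mean (F t).
Proof.
rewrite /mean big_split /= -bigA_distr_bigA /= card_ffun natrX.
by congr (_ * _); rewrite prodr_const exprVn.
Qed.

Lemma mean_ffun1 (f : I -> R) t : mean (fun e : {ffun T -> I} => f (e t)) = mean f.
Proof.
pose F t' x := if t' == t then f x else 1.
have := mean_ffun_prod F.
rewrite (bigD1 t) //= /F eqxx big1 ?mulr1 => [<-|i /negbTE ->].
  apply: eq_mean => e; rewrite (bigD1 t) //= eqxx big1 ?mulr1 // => i /negbTE -> //.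
by rewrite mean_const.
Qed.

Lemma mean_ffun2 (f g : I -> R) t u : t != u ->
  mean (fun e : {ffun T -> I} => f (e t) * g (e u)) = mean f * mean g.
Proof.
move=> tu; pose F t' x := if t' == t then f x else if t' == u then g x else 1.
have E (h : (I -> R) -> R) : h (fun=> 1) = 1 ->
    \prod_t' h (F t') = h f * h g.
  move=> h1; rewrite (bigD1 t) //= (bigD1 u) 1?eq_sym //= /F !eqxx.
  rewrite [u == t]eq_sym (negbTE tu) big1 ?mulr1 // => i /andP[/negbTE -> /negbTE ->].
  exact: h1.
rewrite -(E (@mean R I)); last exact: mean_const.
rewrite -mean_ffun_prod; apply: eq_mean => e.
rewrite (bigD1 t) //= (bigD1 u) 1?eq_sym //= /F !eqxx.
rewrite [u == t]eq_sym (negbTE tu) big1 ?mulr1 // => i /andP[/negbTE -> /negbTE -> //].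
Qed.

End RandomCode.

(** * The one-shot random coding bound *)

Section RandomCoding.
Variables (T I O : finType) (p : T -> R) (w : I -> O -> R) (s : R).
Hypotheses (p_ge0 : forall m, 0 <= p m) (p_sum1 : \sum_m p m = 1).
Hypothesis w_ge0 : forall x y, 0 <= w x y.
Hypotheses (I_gt0 : (0 < #|I|)%N) (s01 : 0 < s < 1).

Let q y := mean (w ^~ y).

Lemma map_decoder_exists (m0 : T) (e : {ffun T -> I}) :
  exists d : {ffun O -> T}, forall y m, p m * w (e m) y <= p (d y) * w (e (d y)) y.
Proof.
exists [ffun y => [arg max_(m > m0) (p m * w (e m) y)]%O] => y m.
by rewrite ffunE; case: arg_maxP => // m' _; apply.
Qed.

Lemma mean_map_error (d : {ffun T -> I} -> {ffun O -> T}) m y :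
  (forall (e : {ffun T -> I}) y' m', p m' * w (e m') y' <= p (d e y') * w (e (d e y')) y') ->
  mean (fun e : {ffun T -> I} => if d e y != m then p m * w (e m) y else 0)
    <= epow (p m) (1 - s) * (mean (fun x => epow (w x y) (1 - s)) * epow (q y) s).
Proof.
move=> dP; have [s0 s1] := andP s01.
have code_gt0 : (0 < #|{ffun T -> I}|)%N by rewrite card_ffun expn_gt0 I_gt0.
have mW0 : 0 <= mean (fun x => epow (w x y) (1 - s)).
  by apply: mean_ge0 => x; exact: epow_ge0.
have : 0 <= q y by exact: mean_ge0.
(* The tangent point [q y] must be positive. If it is 0, then [w x y] is 0 for every input [x] and
   no error mass sits at [y]. *)
rewrite le_eqVlt => /predU1P[q0|q_gt0].
  have w0 := mean_eq0 I_gt0 (w_ge0 ^~ y) (esym q0).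
  rewrite (_ : mean _ = 0); first by do 2?apply: mulr_ge0; rewrite ?epow_ge0.
  rewrite -[RHS](mean_const (0 : R) code_gt0); apply: eq_mean => e.
  by rewrite w0 mulr0 if_same.
pose B (e : {ffun T -> I}) := \sum_(m' | m' != m) p m' * w (e m') y.
pose c := epow (p m) (1 - s) * epow (q y) s.
have c0 : 0 <= c by rewrite mulr_ge0 ?epow_ge0.
pose W x := epow (w x y) (1 - s).
apply: (@le_trans _ _ (mean (fun e : {ffun T -> I} =>
    c * (1 - s) * W (e m) + c * (s / q y) * (\sum_(m' | m' != m) p m' * (W (e m) * w (e m') y))))).
  apply: le_mean => e.
  have -> : c * (1 - s) * W (e m) + c * (s / q y) * (\sum_(m' | m' != m) p m' * (W (e m) * w (e m') y))
      = epow (p m * w (e m) y) (1 - s) * epow (q y) s * (1 - s + s * (B e / q y)).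
    have -> : \sum_(m' | m' != m) p m' * (W (e m) * w (e m') y) = W (e m) * B e.
      by rewrite mulr_sumr; apply: eq_bigr => m' _; rewrite mulrCA.
    by rewrite epowM // /c /W; ring.
  case: ifPn => [dm|_].
    (* On an error, the decoded message differs from [m], so its score, which dominates that of [m],
       is one of the summands of [B e]. *)
    apply: epow_young => //; rewrite mulr_ge0 //=.
    apply: le_trans (dP e y m) _; rewrite /B (bigD1 (d e y)) //= lerDl.
    by apply: sumr_ge0 => m' _; rewrite mulr_ge0.
  have Bq : 0 <= B e / q y.
    by apply: divr_ge0; [apply: sumr_ge0 => m' _; rewrite mulr_ge0 | exact: ltW].
  apply: mulr_ge0; first by rewrite mulr_ge0 ?epow_ge0.
  by apply: addr_ge0; [rewrite subr_ge0 ltW | rewrite mulr_ge0 // ltW].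
rewrite meanD !meanZ mean_sum mean_ffun1 //.
have -> : \sum_(m' | m' != m) mean (fun e : {ffun T -> I} => p m' * (W (e m) * w (e m') y))
    = (\sum_(m' | m' != m) p m') * (mean W * q y).
  rewrite mulr_suml; apply: eq_bigr => m' m'm.
  by rewrite meanZ (@mean_ffun2 _ _ _ _ W (w ^~ y)) // eq_sym.
(* The competing messages have total probability at most 1, so the affine factor 1 - s + s S is at
   most 1. *)
set S := \sum_(_ | _) _; have S1 : S <= 1.
  by rewrite -p_sum1 [X in _ <= X](bigD1 m) //= lerDr.
rewrite -/W (_ : _ + _ = c * mean W * (1 - s + s * S)); last first.
  by field; rewrite gt_eqF.
rewrite [X in _ <= X](_ : _ = c * mean W * 1); last by rewrite /c; ring.
apply: ler_wpM2l; first exact: mulr_ge0.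
by rewrite -[X in _ <= X](subrK s 1) lerD2l -[X in _ <= X]mulr1 ler_wpM2l // ltW.
Qed.

(** Each code book is paired with its own MAP decoder; some code book does no worse than the average
    over all of them, which [mean_map_error] bounds term by term. *)
Lemma random_coding_bound (m0 : T) : exists (e : {ffun T -> I}) (d : {ffun O -> T}),
  \sum_m p m * \sum_y (if d y != m then w (e m) y else 0)
   <= (\sum_m epow (p m) (1 - s)) *
      \sum_y mean (fun x => epow (w x y) (1 - s)) * epow (q y) s.
Proof.
have [d dP] := boolp.choice (map_decoder_exists m0).
have code_gt0 : (0 < #|{ffun T -> I}|)%N by rewrite card_ffun expn_gt0 I_gt0.
pose err (e : {ffun T -> I}) := \sum_m \sum_y (if d e y != m then p m * w (e m) y else 0).
have [e eP] := exists_le_mean err code_gt0.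
exists e, (d e).
have -> : \sum_m p m * \sum_y (if d e y != m then w (e m) y else 0) = err e.
  apply: eq_bigr => m _; rewrite mulr_sumr; apply: eq_bigr => y _.
  by case: ifP => _; rewrite ?mulr0.
apply: le_trans eP _; rewrite mean_sum mulr_suml; apply: ler_sum => m _.
rewrite mean_sum mulr_sumr; apply: ler_sum => y _.
exact: mean_map_error.
Qed.

End RandomCoding.

(** * Irreducibility and the Perron-Frobenius eigenvalue *)

Lemma mpow_iter (T : finType) (A : T -> T -> R) n a b :
  mpow A n a b = iter n (mact A) (fun k => (k == b)%:R) a.
Proof.
elim: n a => [|n IH] a /=; first by case: eqP.
by apply: eq_bigr => c _; rewrite IH.
Qed.

Lemma mpow_ge0 (T : finType) (A : T -> T -> R) n a b :
  (forall i j, 0 <= A i j) -> 0 <= mpow A n a b.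
Proof.
by move=> A0; rewrite mpow_iter; apply: iter_mact_ge0 => // i; rewrite ler0n.
Qed.

Lemma mpow_support (T : finType) (W A : T -> T -> R) n a b :
  (forall i j, 0 <= W i j) -> (forall i j, 0 <= A i j) ->
  (forall i j, 0 < W i j -> 0 < A i j) -> 0 < mpow W n a b -> 0 < mpow A n a b.
Proof.
move=> W0 A0 WA; elim: n a => [|n IH] a //= h.
have /existsP[c Wc] : [exists c, 0 < W a c * mpow W n c b].
  apply: contraLR h => /existsPn h; rewrite -leNgt; apply: sumr_le0 => c _.
  by rewrite leNgt h.
have {Wc} [Wc mc] : 0 < W a c /\ 0 < mpow W n c b.
  move: Wc; have := W0 a c; rewrite le_eqVlt => /predU1P[<-|Wac]; first by rewrite mul0r ltxx.
  by rewrite pmulr_rgt0.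
rewrite -[X in _ < X]/(\sum_c A a c * mpow A n c b) (bigD1 c) //=.
apply: ltr_pwDl; first by rewrite mulr_gt0 ?WA ?IH.
by apply: sumr_ge0 => c' _; rewrite mulr_ge0 ?mpow_ge0.
Qed.

(** Irreducibility is a property of the zero pattern alone. This transfers it from [Ws] and [Wc] to
    the tilted kernels, whose entries are positive wherever theirs are. *)
Lemma irreducible_support (T : finType) (W A : T -> T -> R) :
  (forall i j, 0 <= W i j) -> (forall i j, 0 <= A i j) ->
  (forall i j, 0 < W i j -> 0 < A i j) -> irreducible W -> irreducible A.
Proof.
move=> W0 A0 WA irr a b; have [n [n0 /RltP h]] := irr a b.
by exists n; split => //; apply/RltP; exact: mpow_support h.
Qed.

(** The existence theorem makes the choice by [epsilon] meaningful. Were the eigenvalue 0,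
    positivity of [v] would force row [t0] of [A] to vanish, and then no path of positive length
    could return to [t0]. *)
Lemma PFeig_spec (T : finType) (A : T -> T -> R) (t0 : T) :
  (forall i j, 0 <= A i j) -> irreducible A ->
  0 < PFeig A /\
  exists v : T -> R, (forall i, 0 < v i) /\ forall i, \sum_j A i j * v j = PFeig A * v i.
Proof.
move=> A0 irr; rewrite /PFeig.
set Q := fun l : R => _; have exQ : exists l, Q l.
  have [i j|l [v [v0 Av]]] := perron_frobenius_exists A0 _ t0.
    by have [n [_ /RltP]] := irr i j; rewrite mpow_iter; exists n.
  by exists l, v; split => [i|//]; exact/RltP.
have [v [v0 Av]] := epsilon_spec (inhabits (IZR 0)) Q exQ.
set l := epsilon _ _ in Av *.
have {}v0 i : 0 < v i by exact/RltP.
split; last by exists v.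
have [[|n] [n0 /RltP h]] := irr t0 t0; first by [].
rewrite -(pmulr_lgt0 _ (v0 t0)) -[X in _ < X]Av lt_neqAle eq_sym sumr_ge0 ?andbT; last first.
  by move=> j _; rewrite mulr_ge0 // ltW.
apply/eqP => /(psumr_eq0P (fun j _ => mulr_ge0 (A0 t0 j) (ltW (v0 j)))) E.
move: h; rewrite [mpow _ _ _ _]big1 ?ltxx // => c _; have /eqP := E c isT.
by rewrite mulf_eq0 (gt_eqF (v0 c)) orbF => /eqP ->; exact: mul0r.
Qed.

(** * Total mass of chains *)

Lemma big_tupleS (V : nmodType) (T : finType) n (F : seq T -> V) :
  \sum_(t : n.+1.-tuple T) F t = \sum_a \sum_(t : n.-tuple T) F (a :: t).
Proof.
rewrite pair_big /= (reindex (fun p : T * n.-tuple T => [tuple of p.1 :: p.2])) //=.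
exists (fun t : n.+1.-tuple T => (thead t, [tuple of behead t])) => [[a t]|t] _ /=.
  by congr (_, _); apply: val_inj.
by rewrite -tuple_eta.
Qed.

Lemma big_tuple0 (V : nmodType) (T : finType) (F : seq T -> V) :
  \sum_(t : 0.-tuple T) F t = F [::].
Proof.
by rewrite (big_pred1 [tuple]) // => t; exact/esym/eqP/tuple0.
Qed.

Section Chains.
Variable T : finType.
Implicit Types (f g : T -> R) (A B : T -> T -> R).

Lemma chain_rest_ge0 A b t : (forall i j, 0 <= A i j) -> 0 <= chain_rest A b t.
Proof. by move=> A0; elim: t b => [|a t IH] b //=; rewrite mulr_ge0. Qed.

Lemma chainP_ge0 f A t :
  (forall i, 0 <= f i) -> (forall i j, 0 <= A i j) -> 0 <= chainP f A t.
Proof. by move=> f0 A0; case: t => [|a t] //=; rewrite mulr_ge0 ?chain_rest_ge0. Qed.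

Lemma epow_chainP f A s t :
  (forall i, 0 <= f i) -> (forall i j, 0 <= A i j) ->
  epow (chainP f A t) s = chainP (fun i => epow (f i) s) (fun i j => epow (A i j) s) t.
Proof.
move=> f0 A0.
have rest b u : epow (chain_rest A b u) s = chain_rest (fun i j => epow (A i j) s) b u.
  by elim: u b => [|a u IH] b /=; rewrite ?epow1 // epowM ?chain_rest_ge0 // IH.
by case: t => [|a t] /=; rewrite ?epow1 // epowM ?chain_rest_ge0 // rest.
Qed.

Lemma chainP_mul_map (U : finType) (h : T -> U) f A (g : U -> R) (B : U -> U -> R) t :
  chainP f A t * chainP g B (map h t) =
  chainP (fun i => f i * g (h i)) (fun i j => A i j * B (h i) (h j)) t.
Proof.
have rest b u : chain_rest A b u * chain_rest B (h b) (map h u) =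
    chain_rest (fun i j => A i j * B (h i) (h j)) b u.
  by elim: u b => [|a u IH] b /=; rewrite ?mulr1 // -IH mulrACA.
by case: t => [|a t] /=; rewrite ?mulr1 // -rest mulrACA.
Qed.

(** The previous state is the column index, so weighting it by the right eigenvector and summing
    over it yields one factor [l] and the same weight on the next state. *)
Lemma sum_chain_rest_eigen A l v n :
  (forall i, \sum_j A i j * v j = l * v i) ->
  \sum_b v b * (\sum_(t : n.-tuple T) chain_rest A b t) = l ^+ n * \sum_b v b.
Proof.
move=> Av; elim: n => [|n IH].
  by rewrite mul1r; apply: eq_bigr => b _; rewrite big_tuple0 mulr1.
rewrite exprS -mulrA -IH mulr_sumr.
under eq_bigr do rewrite big_tupleS mulr_sumr.
rewrite exchange_big /=; apply: eq_bigr => a _.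
rewrite mulrA -Av mulr_suml; apply: eq_bigr => b _.
by rewrite -mulr_sumr mulrCA mulrA.
Qed.

Lemma sum_chainP_le f A l v :
  (forall i, 0 <= f i) -> (forall i j, 0 <= A i j) -> (forall i, 0 < v i) -> 0 < l ->
  (forall i, \sum_j A i j * v j = l * v i) ->
  exists2 C : R, 0 < C & forall n, \sum_(t : n.-tuple T) chainP f A t <= C * l ^+ n.
Proof.
move=> f0 A0 v0 l0 Av.
pose D := \sum_i f i / v i; pose V := \sum_i v i.
have fv0 i : 0 <= f i / v i by rewrite divr_ge0 // ltW.
have D0 : 0 <= D by exact: sumr_ge0.
have V0 : 0 <= V by apply: sumr_ge0 => i _; exact: ltW.
have K0 : 0 <= D * V / l by rewrite mulr_ge0 ?mulr_ge0 // invr_ge0 ltW.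
(* The initial weight satisfies f <= D v pointwise. A word of length n + 1 has only n transitions,
   whence the division by [l]; the summand 1 covers the empty word and keeps the constant positive
   when [D] is 0. *)
exists (1 + D * V / l); first by rewrite ltr_pwDl.
case=> [|n]; first by rewrite big_tuple0 mulr1 lerDl.
apply: (@le_trans _ _ (D * V / l * l ^+ n.+1)); last first.
  by rewrite ler_wpM2r ?exprn_ge0 ?ltW // ltrDr.
have -> : D * V / l * l ^+ n.+1 = D * (l ^+ n * V) by rewrite exprS; field; rewrite gt_eqF.
rewrite -(sum_chain_rest_eigen n Av) big_tupleS mulr_sumr; apply: ler_sum => a _.
rewrite -mulr_sumr mulrA ler_wpM2r //; first by apply: sumr_ge0 => t _; exact: chain_rest_ge0.
by rewrite -ler_pdivrMr // /D (bigD1 a) //= lerDl sumr_ge0.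
Qed.

End Chains.

Lemma sum_chain_rest1 (T : finType) (W : T -> T -> R) n b :
  is_transition W -> \sum_(t : n.-tuple T) chain_rest W b t = 1.
Proof.
move=> [_ W1]; elim: n b => [|n IH] b; first by rewrite big_tuple0.
rewrite big_tupleS -[RHS](W1 b); apply: eq_bigr => a _.
by rewrite -mulr_sumr IH mulr1.
Qed.

Lemma sum_chainP1 (T : finType) (P : T -> R) (W : T -> T -> R) n :
  is_distr P -> is_transition W -> \sum_(t : n.-tuple T) chainP P W t = 1.
Proof.
move=> [_ P1] W1; case: n => [|n]; first by rewrite big_tuple0.
rewrite big_tupleS -[RHS]P1; apply: eq_bigr => a _.
by rewrite -mulr_sumr sum_chain_rest1 // mulr1.
Qed.

(** * Additive noise and the marginal chain on [Z] *)

Section AdditiveNoise.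
Variables (X : finZmodType) (Z : finType).
Implicit Types (G : seq (X * Z) -> R) (y : seq (X * Z)) (x : seq X).

Let noise y x := map (fun p : (X * Z) * X => (p.1.1 - p.2, p.1.2)) (zip y x).

Lemma unzip2_noise y x : size x = size y -> unzip2 (noise y x) = unzip2 y.
Proof. by elim: y x => [|[a z] y IH] [|b x] //= [/IH]; rewrite /noise => ->. Qed.

(** For a fixed input, the noise is a translate of the output, and translations permute the
    group. *)
Lemma sum_noise_output G n x : size x = n ->
  \sum_(y : n.-tuple (X * Z)) G (noise y x) = \sum_(y : n.-tuple (X * Z)) G y.
Proof.
elim: n x G => [|n IH] x G.
  by move=> /size0nil ->; rewrite (big_tuple0 (fun y => G (noise y [::]))) big_tuple0.
case: x => //= b x [sx].
rewrite (big_tupleS _ (fun y => G (noise y (b :: x)))) big_tupleS /=.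
rewrite [RHS](reindex (fun a : X * Z => (a.1 - b, a.2))) /=; last first.
  exists (fun a : X * Z => (a.1 + b, a.2)) => -[a z] _ /=; by rewrite ?subrK ?addrK.
by apply: eq_bigr => a _; rewrite (IH x (fun y => G (_ :: y))).
Qed.

(** For a fixed output letter [a], the map from [b] to [a - b] is an involution. Uniform inputs thus
    make the group part of the noise uniform while the [Z] part stays that of [y]. *)
Lemma sum_noise_input G n y : size y = n ->
  \sum_(x : n.-tuple X) G (noise y x) = \sum_(x : n.-tuple X) G (zip x (unzip2 y)).
Proof.
elim: n y G => [|n IH] y G.
  move=> /size0nil ->; rewrite (big_tuple0 (fun x => G (noise [::] x))).
  by rewrite (big_tuple0 (fun x => G (zip x [::]))).
case: y => //= -[a z] y [sy].
rewrite (big_tupleS _ (fun x => G (noise ((a, z) :: y) x))).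
rewrite (big_tupleS _ (fun x => G (zip x (z :: unzip2 y)))) /=.
rewrite [RHS](reindex (fun b => a - b)) /=; last first.
  by exists (fun b => a - b) => b _; rewrite subKr.
by apply: eq_bigr => b _; rewrite (IH y (fun y => G (_ :: y))).
Qed.

(** Under Assumption 1 the mass of the continuations does not depend on the group part of the
    current state, so the sums over group letters can be taken one at a time. *)
Lemma sum_chainP_zip (f : X * Z -> R) (W : X * Z -> X * Z -> R) n z :
  assumption1 W -> size z = n ->
  \sum_(x : n.-tuple X) chainP f W (zip x z) =
  chainP (fun c => \sum_a f (a, c)) (WcZ W) z.
Proof.
move=> W1.
have rest m u b c : size u = m ->
    \sum_(x : m.-tuple X) chain_rest W (b, c) (zip x u) = chain_rest (WcZ W) c u.
  elim: m u b c => [|m IH] [|c' u] b c //= => [_|[su]].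
    by rewrite (big_tuple0 (fun x => chain_rest W (b, c) (zip x [::]))).
  rewrite (big_tupleS _ (fun x => chain_rest W (b, c) (zip x (c' :: u)))) /=.
  rewrite -[RHS]/(WcZ W c' c * chain_rest (WcZ W) c' u).
  have -> : WcZ W c' c = \sum_a W (a, c') (b, c) by exact: W1.
  by rewrite mulr_suml; apply: eq_bigr => a _; rewrite -mulr_sumr IH.
case: n z => [|n] [|c z] //= => [_|[sz]].
  by rewrite (big_tuple0 (fun x => chainP f W (zip x [::]))).
rewrite (big_tupleS _ (fun x => chainP f W (zip x (c :: z)))) /=.
rewrite -[RHS]/((\sum_a f (a, c)) * chain_rest (WcZ W) c z).
by rewrite mulr_suml; apply: eq_bigr => a _; rewrite -mulr_sumr rest.
Qed.

End AdditiveNoise.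

(** * From the one-shot bound to chains with tilted kernels *)

Lemma Pj_le_err (M : finType) (X : finZmodType) (Z : finType)
  (PM1 : M -> R) (Ws : M -> M -> R) (PXZ1 : X * Z -> R) (Wc : X * Z -> X * Z -> R) k n (c : code_type M X Z k n) :
  Pj PM1 Ws PXZ1 Wc k n <= err_prob PM1 Ws PXZ1 Wc c.
Proof.
have foldP (a x : R) l : x \in l -> (foldr Rmin a l <= x)%R.
  elim: l => //= b l IH; rewrite inE => /predU1P[->|/IH h].
    by apply/RleP; exact: Rmin_l.
  by apply: le_trans h; apply/RleP; exact: Rmin_r.
by apply: foldP; apply: map_f; rewrite mem_enum.
Qed.

Lemma Pj_ge0 (M : finType) (X : finZmodType) (Z : finType)
  (PM1 : M -> R) (Ws : M -> M -> R) (PXZ1 : X * Z -> R) (Wc : X * Z -> X * Z -> R) k n :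
  (forall i, 0 <= PM1 i) -> (forall i j, 0 <= Ws i j) ->
  (forall i, 0 <= PXZ1 i) -> (forall i j, 0 <= Wc i j) ->
  0 <= Pj PM1 Ws PXZ1 Wc k n.
Proof.
move=> PM0 Ws0 PX0 Wc0.
have foldP (a : R) l : 0 <= a -> (forall x, x \in l -> 0 <= x) -> 0 <= foldr Rmin a l.
  move=> a0; elim: l => //= b l IH h.
  by rewrite RminE le_min h ?mem_head //= IH // => x xl; rewrite h // inE xl orbT.
have err0 (c : code_type M X Z k n) : 0 <= err_prob PM1 Ws PXZ1 Wc c.
  apply: sumr_ge0 => m _; apply: mulr_ge0; first exact: chainP_ge0.
  by apply: sumr_ge0 => y _; case: ifP => // _; exact: chainP_ge0.
apply: foldP => [|x /mapP[c _ ->] //].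
by case: (enum _) => [|c l] //=.
Qed.

Lemma joint_coding_bound (M : finType) (X : finZmodType) (Z : finType)
  (PM1 : M -> R) (Ws : M -> M -> R) (PXZ1 : X * Z -> R) (Wc : X * Z -> X * Z -> R) k n (m0 : M) s :
  is_distr PM1 -> is_transition Ws ->
  (forall i, 0 <= PXZ1 i) -> (forall i j, 0 <= Wc i j) -> assumption1 Wc -> 0 < s < 1 ->
  Pj PM1 Ws PXZ1 Wc k n <=
  (\sum_(t : k.-tuple M) chainP (fun i => epow (PM1 i) (1 - s)) (fun i j => epow (Ws i j) (1 - s)) t) *
  (epow (#|X|%:R ^+ n)^-1 s *
   \sum_(t : n.-tuple (X * Z))
      chainP (fun i => epow (PXZ1 i) (1 - s) * epow (\sum_a PXZ1 (a, i.2)) s)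
             (fun a b => epow (Wc a b) (1 - s) * epow (WcZ Wc a.2 b.2) s) t).
Proof.
move=> PMd Wst PX0 Wc0 W1 s01.
have PM0 i : 0 <= PM1 i by apply/RleP; exact: PMd.1.
have Ws0 i j : 0 <= Ws i j by apply/RleP; exact: Wst.1.
have WZ0 i j : 0 <= WcZ Wc i j by exact: sumr_ge0.
have PZ0 i : 0 <= \sum_a PXZ1 (a, i) by exact: sumr_ge0.
pose w (x : n.-tuple X) (y : n.-tuple (X * Z)) := chainP PXZ1 Wc (noise_of y x).
have w0 x y : 0 <= w x y by exact: chainP_ge0.
have X0 : (0 < #|X|)%N by apply/card_gt0P; exists 0.
have I0 : (0 < #|{: n.-tuple X}|)%N by rewrite card_tuple expn_gt0 X0.
(* The constant word on [m0] only witnesses that there is a message for the arg max to start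
   from. *)
have [e [d le]] := random_coding_bound (fun m : k.-tuple M => chainP_ge0 m PM0 Ws0)
  (sum_chainP1 k PMd Wst) w0 I0 s01 [tuple of nseq k m0].
apply: le_trans (Pj_le_err PM1 Ws PXZ1 Wc (e, d)) _.
apply: le_trans le _.
have -> : \sum_(t : k.-tuple M) epow (chainP PM1 Ws t) (1 - s) =
   \sum_(t : k.-tuple M) chainP (fun i => epow (PM1 i) (1 - s)) (fun i j => epow (Ws i j) (1 - s)) t.
  by apply: eq_bigr => t _; rewrite epow_chainP.
apply: ler_wpM2l.
  by apply: sumr_ge0 => t _; apply: chainP_ge0 => *; exact: epow_ge0.
pose N : R := #|X|%:R ^+ n.
have N0 : 0 < N by rewrite exprn_gt0 // ltr0n.
(* [H] is the summand of the bound as a function of the noise alone; this is possible because the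
   noise keeps the [Z] part of the output. *)
pose H t := epow (chainP PXZ1 Wc t) (1 - s) *
  epow (N^-1 * chainP (fun c => \sum_a PXZ1 (a, c)) (WcZ Wc) (unzip2 t)) s.
have qE y : mean (w ^~ y) = N^-1 * chainP (fun c => \sum_a PXZ1 (a, c)) (WcZ Wc) (unzip2 y).
  rewrite /mean card_tuple natrX mulrC; congr (_ * _).
  rewrite -(sum_chainP_zip PXZ1 W1 (n := n)) ?size_map ?size_tuple //.
  exact: (sum_noise_input (chainP PXZ1 Wc) (size_tuple y)).
have HE t : H t = epow N^-1 s * chainP
    (fun i => epow (PXZ1 i) (1 - s) * epow (\sum_a PXZ1 (a, i.2)) s)
    (fun a b => epow (Wc a b) (1 - s) * epow (WcZ Wc a.2 b.2) s) t.
  rewrite /H epowM ?invr_ge0 ?(ltW N0) ?chainP_ge0 // mulrCA !epow_chainP //.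
  by rewrite (chainP_mul_map (fun i : X * Z => i.2)).
(* Exchange the sum over outputs with the mean over inputs. For each input the sum over outputs
   equals the sum of [H] over all noise words, so the mean is one of a constant. *)
have -> : \sum_y mean (fun x => epow (w x y) (1 - s)) * epow (mean (w ^~ y)) s =
    \sum_(y : n.-tuple (X * Z)) H y.
  rewrite -[RHS](mean_const _ I0).
  rewrite -(eq_mean (fun x : n.-tuple X => sum_noise_output H (size_tuple x))).
  rewrite mean_sum; apply: eq_bigr => y _.
  rewrite mulrC -meanZ; apply: eq_mean => x.
  by rewrite mulrC qE /H unzip2_noise // !size_tuple.
by rewrite mulr_sumr le_eqVlt; apply/orP; left; apply/eqP/eq_bigr => t _; rewrite HE.
Qed.

(** * Exponents and the final bound *)

Local Open Scope R_scope.

Lemma floor_nat_bounds x : 0 <= x -> x - 1 < INR (floor_nat x) <= x.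
Proof.
move=> x0; have [h1 h2] := base_Int_part x.
have z0 : Z.le 0 (Int_part x).
  (* The integer part exceeds -1, hence is nonnegative, and [Z.to_nat] does not truncate it. *)
  have /lt_IZR : IZR (Zneg xH) < IZR (Int_part x) by Lra.lra.
  by Lia.lia.
by rewrite /floor_nat INR_IZR_INZ Znat.Z2Nat.id //; Lra.lra.
Qed.

(** After taking logarithms, the constant costs at most |ln C|, and replacing the floor of r n by r
    n costs at most |ln ls|, whatever the sign of ln ls. Both are absorbed once n eps exceeds their
    sum [D]. *)
Lemma exponent_of_bound (C ls lc K r s eps : R) :
  0 < C -> 0 < ls -> 0 < lc -> 0 < K -> 0 < r -> 0 < eps ->
  exists N : nat, forall n, (N <= n)%N -> forall P : R, 0 < P ->
    P <= C * (ls ^ floor_nat (r * INR n) * (Rpower (/ K ^ n) s * lc ^ n)) ->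
    - ln P / INR n >= s * ln K - (r * ln ls + ln lc) - eps.
Proof.
move=> C0 ls0 lc0 K0 r0 eps0.
pose D := Rabs (ln C) + Rabs (ln ls).
have [N NP] := INR_unbounded (D / eps).
exists N.+1 => n Nn P P0 Pn.
have n0 : 0 < INR n by apply: (lt_INR 0); apply/ssrnat.ltP; exact: leq_trans Nn.
have {NP} nD : D < INR n * eps.
  have h : INR N < INR n by apply: lt_INR; apply/ssrnat.ltP.
  have -> : D = D / eps * eps by rewrite /Rdiv Rmult_assoc Rinv_l ?Rmult_1_r //; Lra.lra.
  by apply: Rmult_lt_compat_r => //; Lra.lra.
have rn0 : 0 <= r * INR n by apply: Rmult_le_pos; exact: Rlt_le.
have := floor_nat_bounds rn0; set k := floor_nat _ in Pn * => -[k1 k2].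
have Kn0 : 0 < K ^ n by exact: pow_lt.
have lnP : ln P <= ln C + (INR k * ln ls + (s * - (INR n * ln K) + INR n * ln lc)).
  have -> : ln C + (INR k * ln ls + (s * - (INR n * ln K) + INR n * ln lc))
      = ln (C * (ls ^ k * (Rpower (/ K ^ n) s * lc ^ n))).
    have pow_pos x m : 0 < x -> 0 < x ^ m by exact: pow_lt.
    have Rp0 : 0 < Rpower (/ K ^ n) s by exact: exp_pos.
    have h1 : 0 < Rpower (/ K ^ n) s * lc ^ n by apply: Rmult_lt_0_compat; auto.
    have h2 : 0 < ls ^ k * (Rpower (/ K ^ n) s * lc ^ n) by apply: Rmult_lt_0_compat; auto.
    rewrite (ln_mult _ _ C0 h2) (ln_mult _ _ (pow_pos _ k ls0) h1).
    rewrite (ln_mult _ _ Rp0 (pow_pos _ n lc0)).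
    by rewrite !ln_pow // /Rpower ln_exp ln_Rinv // ln_pow.
  case: Pn => [/(ln_increasing _ _ P0)/Rlt_le //|<-]; exact: Rle_refl.
have le_abs : - Rabs (ln ls) <= (r * INR n - INR k) * ln ls.
  have [h|h] := Rle_dec 0 (ln ls); first by rewrite Rabs_pos_eq //; Psatz.nra.
  by rewrite Rabs_left; Psatz.nra.
have hC := Rle_abs (ln C).
apply: Rle_ge; apply: (Rmult_le_reg_r (INR n)) => //.
have -> : - ln P / INR n * INR n = - ln P.
  by rewrite /Rdiv Rmult_assoc Rinv_l ?Rmult_1_r //; Lra.lra.
by rewrite /D in nD; Psatz.nra.
Qed.

Theorem mainTheorem12
  (M : finType) (X : finZmodType) (Z : finType)
  (PM1 : M -> R) (Ws : M -> M -> R)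
  (PXZ1 : (X * Z) -> R) (Wc : (X * Z) -> (X * Z) -> R)
  (r HsV HcV : R) :
  is_distr PM1 -> is_transition Ws -> irreducible Ws -> aperiodic Ws ->
  is_distr PXZ1 -> is_transition Wc -> irreducible Wc -> aperiodic Wc ->
  assumption1 Wc ->
  0 < r ->
  (* H^{W_s}(M) = lim_{theta -> 0} H_{1-theta}^{W_s}(M) *)
  limit1_in (fun theta => thetaHs Ws theta / theta) (fun theta => theta <> 0) HsV 0 ->
  (* H^{W_c}(X|Z) = lim_{theta -> 0} H_{1-theta}^{W_c,down}(X|Z) *)
  limit1_in (fun theta => thetaHc Wc theta / theta) (fun theta => theta <> 0) HcV 0 ->
  r * HsV + HcV < ln (INR #|X|) ->
  (* liminf_n -(1/n) log P_j(floor(rn), n) >= sup_{s in (0,1)} [sR - U(s)] *)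
  forall s : R, 0 < s < 1 ->
  forall eps : R, 0 < eps ->
  exists N : nat, forall n : nat, (N <= n)%nat ->
    Pj PM1 Ws PXZ1 Wc (floor_nat (r * INR n)) n = 0 \/
    - ln (Pj PM1 Ws PXZ1 Wc (floor_nat (r * INR n)) n) / INR n >=
      s * ln (INR #|X|) - Ufun Ws Wc r s - eps.
Proof.
move=> PMd Wst Wsirr _ PXd Wct Wcirr _ W1 r0 _ _ _ s [/RltP s0 /RltP s1] eps eps0.
have s01 : (0 < s < 1)%R by rewrite s0.
have nonempty (T : finType) (P : T -> R) : is_distr P -> inhabited T.
  move=> [_ P1]; case: (pickP (xpredT : pred T)) => [t _|h]; first by exists.
  by move: P1; rewrite big_pred0 // => /esym/R1_neq_R0.
have [m0] := nonempty _ _ PMd; have [c0] := nonempty _ _ PXd.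
have PM0 i : (0 <= PM1 i)%R by apply/RleP; exact: PMd.1.
have Ws0 i j : (0 <= Ws i j)%R by apply/RleP; exact: Wst.1.
have PX0 i : (0 <= PXZ1 i)%R by apply/RleP; exact: PXd.1.
have Wc0 i j : (0 <= Wc i j)%R by apply/RleP; exact: Wct.1.
pose As i j := epow (Ws i j) (1 - s).
pose Ac a b := epow (Wc a b) (1 - s) * epow (WcZ Wc a.2 b.2) s.
have As0 i j : (0 <= As i j)%R by exact: epow_ge0.
have Ac0 i j : (0 <= Ac i j)%R by rewrite mulr_ge0 ?epow_ge0.
have Asirr : irreducible As.
  by apply: irreducible_support Wsirr => // i j; exact: epow_gt0.
have Acirr : irreducible Ac.
  (* A positive entry of [Wc] is a summand of the corresponding entry of [WcZ], by Assumption 1, so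
     the second tilted factor is positive too. *)
  apply: irreducible_support Wcirr => // -[x z] [x' z'] h.
  apply: mulr_gt0; apply: epow_gt0 => //=.
  have -> : WcZ Wc z z' = (\sum_a Wc (a, z) (x', z'))%R by exact: W1.
  by rewrite (bigD1 x) //= ltr_pwDl // sumr_ge0.
have [ls0 [vs [vs0 Avs]]] := PFeig_spec m0 As0 Asirr.
have [lc0 [vc [vc0 Avc]]] := PFeig_spec c0 Ac0 Acirr.
have fs0 i : (0 <= epow (PM1 i) (1 - s))%R by exact: epow_ge0.
pose fc (i : X * Z) := epow (PXZ1 i) (1 - s) * epow (\sum_a PXZ1 (a, i.2))%R s.
have fc0 i : (0 <= fc i)%R by rewrite mulr_ge0 ?epow_ge0.
have [Cs Cs0 les] := sum_chainP_le fs0 As0 vs0 ls0 Avs.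
have [Cc Cc0 lec] := sum_chainP_le fc0 Ac0 vc0 lc0 Avc.
have K0 : 0 < INR #|X| by apply: (lt_INR 0); apply/ssrnat.ltP/card_gt0P; exists 0%R.
have /RltP C0 := mulr_gt0 Cs0 Cc0.
have [/RltP ls0' /RltP lc0'] := (ls0, lc0).
have [N NP] := exponent_of_bound s C0 ls0' lc0' K0 r0 eps0.
exists N => n Nn.
have := Pj_ge0 (floor_nat (r * INR n)) n PM0 Ws0 PX0 Wc0.
(* At error probability 0 the exponent is infinite while [ln] returns a default value; the left
   alternative records this case. *)
rewrite le_eqVlt => /predU1P[<-|/RltP P0]; [by left | right].
apply: NP => //; set k := floor_nat _; apply/RleP.
apply: le_trans (joint_coding_bound _ n m0 PMd Wst PX0 Wc0 W1 s01) _.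
have Kn0 : (0 < (#|X|%:R ^+ n)^-1 :> R)%R.
  by rewrite invr_gt0 exprn_gt0 // -INRE; exact/RltP.
rewrite !RpowE INRE RinvE -(epow_Rpower _ Kn0).
(* Regroup into a source factor and a channel factor, each bounded by its own chain estimate. *)
rewrite [X in (_ <= X)%R](_ : _ = (Cs * PFeig As ^+ k) *
    (epow (#|X|%:R ^+ n)^-1 s * (Cc * PFeig Ac ^+ n)))%R; last first.
  by rewrite !RmultE; ring.
apply: ler_pM => //; last by apply: ler_wpM2l; [exact: epow_ge0 | exact: lec].
- by apply: sumr_ge0 => t _; apply: chainP_ge0 => *; exact: epow_ge0.
- apply: mulr_ge0; first exact: epow_ge0.
  apply: sumr_ge0 => t _; apply: chainP_ge0 => *; apply: mulr_ge0; exact: epow_ge0.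
Qed.
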